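(* Let $z\in\mathbb{C}$ be a nonzero purely imaginary degree root of a multigraph of order $n$. Then $$\frac{1}{\sqrt{n-1}}\leq |z|\leq \sqrt{n-1}.$$
   Context: A multigraph is finite, may have multiple edges, and has no loops; its order is its number of vertices. The degree polynomial of a multigraph $G$ with vertex set $V$ is $D(G;x)=\sum_{v\in V} x^{\deg(v)}$, where $\deg(v)$ is the number of edges incident with $v$ (counted with multiplicity). A degree root of $G$ is a complex root of $D(G;x)$. A purely imaginary number is one of the form $ir$ with $r\in\mathbb{R}$. *)

(* Defs.v *)
From HB Require Import structures.
From mathcomp Require Import all_boot all_order all_algebra.
From mathcomp Require Import complex.
From mathcomp Require Import reals.

Set Implicit Arguments.
Unset Strict Implicit.
Unset Printing Implicit Defensive.

Import Order.TTheory GRing.Theory Num.Theory.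
Local Open Scope ring_scope.

(* Edges have their own identity, so distinct edges may share both endpoints;
   loops are excluded because every edge has exactly two endpoints.
   As usual for graphs, the vertex set is nonempty: an empty one would make the
   degree polynomial 0, of which every number is a root. *)
Record multigraph := Multigraph {
  vertex : finType;
  edge : finType;
  ends : edge -> {set vertex};
  card_ends : forall e : edge, #|ends e| = 2%N;
  vertex_nonempty : (0 < #|vertex|)%N
}.

Definition order (G : multigraph) : nat := #|vertex G|.

Definition deg (G : multigraph) (v : vertex G) : nat :=
  #|[set e : edge G | v \in ends e]|.

Definition degree_poly (R : nzRingType) (G : multigraph) : {poly R} :=
  \sum_(v : vertex G) 'X^(deg v).

Definition degree_root (R : realType) (G : multigraph) (z : R[i]) : Prop :=
  root (degree_poly R[i] G) z.

Definition purely_imaginary (R : realType) (z : R[i]) : Prop :=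
  exists r : R, z = ('i * r%:C)%C.

(* Main.v *)
Require Import Defs.
From HB Require Import structures.
From mathcomp Require Import all_boot all_order all_algebra.
From mathcomp Require Import complex.
From mathcomp Require Import reals.

(** Write z = ir. Only the multiset of exponents matters: z is a zero of a sum
    of n powers of z. Consider first |z| <= 1. Dividing by the power with the
    least exponent turns one summand into 1, and the others into powers z^k
    with k >= 0. Their real parts have sum -1, but none of them is very
    negative: the real part of z^k is 1 for k = 0, it is 0 for odd k, and its
    absolute value is |z|^k <= |z|^2 for even k >= 2. Hence 1 <= (n-1)|z|^2
    ([imaginary_power_sum_bound]), which is the lower bound. It also gives
    1 <= n-1, and the upper bound |z|^2 <= n-1 follows as |z| <= 1.

    If |z| > 1, then the reciprocal 1/z is purely imaginary too, and it is a
    zero of the sum obtained by replacing each exponent d by D - d, where D is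
    the greatest exponent. The two bounds for 1/z are those for z in the
    opposite order ([imaginary_zero_bounds]). *)

Set Implicit Arguments.
Unset Strict Implicit.
Unset Printing Implicit Defensive.

Import Order.TTheory GRing.Theory Num.Theory.
Local Open Scope ring_scope.
Local Open Scope complex_scope.

Lemma sqr_imaginary (R : rcfType) (s : R) :
  ('i * s%:C) ^+ 2 = (- s ^+ 2)%:C.
Proof. by rewrite exprMn sqr_i mulN1r -rmorphXn -rmorphN. Qed.

Lemma Re_imaginary_exp (R : rcfType) (s : R) (k : nat) :
  complex.Re (('i * s%:C) ^+ k) = if odd k then 0 else (- s ^+ 2) ^+ k./2.
Proof.
rewrite -{1}(odd_double_half k) exprD -mul2n exprM sqr_imaginary -rmorphXn.
case: (odd k); first by rewrite expr1 /=; simpc.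
by rewrite mul1r.
Qed.

(** The even powers of i * s are real with alternating signs, starting with 1,
    and the odd ones are imaginary. So exponent 2 gives the first negative real
    part, and absolute values do not increase afterwards when |s| <= 1. *)
Lemma Re_imaginary_exp_ge (R : rcfType) (s : R) (k : nat) :
  s ^+ 2 <= 1 -> - s ^+ 2 <= complex.Re (('i * s%:C) ^+ k).
Proof.
move=> s_le1; rewrite Re_imaginary_exp.
case: (odd k); first by rewrite oppr_le0 sqr_ge0.
case: k./2 => [|j].
  by rewrite expr0 (le_trans _ ler01) // oppr_le0 sqr_ge0.
apply: le_trans (lerNnormlW (lexx _)).
rewrite lerN2 normrX normrN (ger0_norm (sqr_ge0 s)) exprS.
by rewrite ler_piMr ?sqr_ge0 // exprn_ile1 ?sqr_ge0.
Qed.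

(** The index m contributes 1 to the real part of the sum, and each of the
    other |V| - 1 terms can take away at most s^2. *)
Lemma imaginary_power_sum_bound (R : rcfType) (V : finType) (e : V -> nat)
    (m : V) (s : R) :
  e m = 0%N -> s ^+ 2 <= 1 -> \sum_v ('i * s%:C) ^+ e v = 0 ->
  1 <= (#|V|%:R - 1) * s ^+ 2.
Proof.
move=> em0 s_le1 sum0.
have: complex.Re (\sum_v ('i * s%:C) ^+ e v) = 0 by rewrite sum0.
rewrite raddf_sum (bigD1 m) //= em0 expr0 => sumRe0.
have sum_const : \sum_(v | v != m) (- s ^+ 2) = (#|V|%:R - 1) * - s ^+ 2.
  rewrite mulrBl mul1r mulr_natl -(sumr_const V) [in RHS](bigD1 m) //=.
  by rewrite addrAC subrr add0r.
have: \sum_(v | v != m) (- s ^+ 2)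
    <= \sum_(v | v != m) complex.Re (('i * s%:C) ^+ e v).
  by apply: ler_sum => v _; apply: Re_imaginary_exp_ge.
rewrite sum_const.
move/eqP: sumRe0; rewrite addrC addr_eq0 => /eqP ->.
by rewrite mulrN lerN2.
Qed.

(** With z = i * s, the sum of the powers z^(d v - min d) is the given sum divided
    by z^(min d), and the sum of the powers (1/z)^(max d - d v) is the given sum
    divided by z^(max d). So both vanish, and [imaginary_power_sum_bound] applies
    to the one whose base has absolute value at most 1. *)
Lemma imaginary_zero_bounds (R : rcfType) (V : finType) (d : V -> nat)
    (v0 : V) (s : R) :
  s != 0 -> \sum_v ('i * s%:C) ^+ d v = 0 ->
  1 <= (#|V|%:R - 1) * s ^+ 2 /\ s ^+ 2 <= #|V|%:R - 1.
Proof.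
move=> s_neq0 sum0.
have s2_gt0 : 0 < s ^+ 2 by rewrite exprn_even_gt0.
have z_neq0 : 'i * s%:C != 0 :> R[i].
  by rewrite -sqrf_eq0 sqr_imaginary eq_complex /= eqxx andbT oppr_eq0 gt_eqF.
have small (e : V -> nat) (m : V) (t : R) : e m = 0%N -> t ^+ 2 <= 1 ->
    \sum_v ('i * t%:C) ^+ e v = 0 ->
  1 <= (#|V|%:R - 1) * t ^+ 2 /\ t ^+ 2 <= #|V|%:R - 1.
  move=> em0 t_le1 /(imaginary_power_sum_bound em0 t_le1) lower; split=> //.
  have t2_ge0 := sqr_ge0 t.
  have n1_gt0 : 0 < #|V|%:R - 1 :> R.
    case: (ltP 0 (#|V|%:R - 1 : R)) => // n1_le0.
    by have := le_trans lower (mulr_le0_ge0 n1_le0 t2_ge0); rewrite ler10.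
  apply: (le_trans t_le1); apply: (le_trans lower).
  by rewrite ler_piMr // ltW.
case: (leP (s ^+ 2) 1) => [s_le1 | /ltW s_ge1].
  have [m _ m_min] := arg_minnP d (isT : predT v0).
  apply: (small (fun v => d v - d m)%N m) => //; first by rewrite subnn.
  apply: (mulfI (expf_neq0 (d m) z_neq0)).
  rewrite mulr0 mulr_sumr -[RHS]sum0; apply: eq_bigr => v _.
  by rewrite -exprD subnKC // m_min.
have [m _ m_max] := arg_maxnP d (isT : predT v0).
(* The base 1/z is again i times a real number, namely -1/s. *)
have zV : 'i * (- s^-1)%:C = ('i * s%:C)^-1.
  apply: (mulfI z_neq0); rewrite divff // mulrACA -expr2 sqr_i mulN1r -rmorphM.
  by rewrite mulrN divff // rmorphN opprK.
have sV_le1 : (- s^-1) ^+ 2 <= 1 by rewrite sqrrN exprVn invf_le1.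
have [||lower upper] := small (fun v => d m - d v)%N m _ _ sV_le1.
- by rewrite subnn.
- apply: (mulfI (expf_neq0 (d m) z_neq0)).
  rewrite mulr0 mulr_sumr -[RHS]sum0; apply: eq_bigr => v _.
  have dv_le : (d v <= d m)%N by apply: m_max.
  rewrite zV -{1}(subnK dv_le) exprD mulrAC -exprMn divff //.
  by rewrite expr1n mul1r.
- move: lower upper; rewrite sqrrN exprVn ler_pdivlMr // mul1r => lower.
  by rewrite -[X in X <= _]div1r ler_pdivrMr.
Qed.

Theorem proposition3p5 (R : realType) (n : nat) (G : multigraph) (z : R[i])
    (order_G : Defs.order G = n) (z_neq0 : z != 0)
    (z_im : purely_imaginary z) (z_root : degree_root G z) :
  (1 / Num.sqrt (n%:R - 1))%:C <= `|z| /\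
  `|z| <= (Num.sqrt (n%:R - 1))%:C.
Proof.
case: z_im => r z_eq.
have r_neq0 : r != 0.
  by apply: contraNneq z_neq0 => r0; rewrite z_eq r0 mulr0.
have /card_gt0P [v0 _] := vertex_nonempty G.
have sum0 : \sum_(v : vertex G) ('i * r%:C) ^+ deg v = 0.
  move/rootP: z_root; rewrite /degree_poly horner_sum z_eq => sum0.
  by rewrite -[RHS]sum0; apply: eq_bigr => v _; rewrite hornerXn.
have := imaginary_zero_bounds v0 r_neq0 sum0.
rewrite -/(Defs.order G) order_G => -[lower upper].
have norm_z : `|z| = (Num.sqrt (r ^+ 2))%:C.
  rewrite z_eq normrM normc_def /= expr0n /= add0r expr1n sqrtr1 mul1r.
  by rewrite normc_def /= expr0n /= addr0.
have n1_gt0 : 0 < n%:R - 1 :> R.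
  by apply: lt_le_trans upper; rewrite exprn_even_gt0.
rewrite norm_z !lecR; split; last by rewrite ler_wsqrtr.
rewrite ler_pdivrMr ?sqrtr_gt0 // mulrC -sqrtrM ?(ltW n1_gt0) //.
by rewrite -[X in X <= _]sqrtr1 ler_wsqrtr.
Qed.
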